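(* Let $S_{k-2,\mathbb R}$ be the space of cusp forms of weight $k-2$ with real Fourier coefficients, and let $f\in DS_{k-2,\mathbb R}$ be a quasimodular form of weight $k$ and depth $1$ (that is, $f=Dg$ for some nonzero $g\in S_{k-2,\mathbb R}$). Then $f$ has at least two zeros in $\mathbb H$, one lying on the line $\{z\in\mathbb H:\Re(z)=0\}$ and the other lying on the line $\{z\in\mathbb H:\Re(z)=1/2\}$.
   Context: All modular forms are for the full modular group $\mathrm{PSL}_2(\mathbb Z)$; $k$ is an even integer; $\mathbb H$ is the upper half-plane, $q=e^{2\pi i z}$, and $D=\frac{1}{2\pi i}\frac{d}{dz}=q\frac{d}{dq}$. The derivative of a non-constant modular form of weight $k-2$ is a quasimodular form of weight $k$ and depth exactly $1$. *)

(* Defs.v *)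
From Stdlib Require Export Reals ZArith.
From Coquelicot Require Export Coquelicot.

Open Scope C_scope.

(* Modular forms are total functions [C -> C] of which only the values on the
   upper half-plane matter; every condition below is restricted to it. *)
Definition upper_half_plane (z : C) : Prop := (0 < Im z)%R.

(* exp (x + i y) = exp x * (cos y + i sin y) *)
Definition Cexp (z : C) : C :=
  ((exp (Re z) * cos (Im z))%R, (exp (Re z) * sin (Im z))%R).

Definition Cpow_Z (z : C) (k : Z) : C :=
  match k with
  | Z0 => 1
  | Zpos p => z ^ Pos.to_nat p
  | Zneg p => / (z ^ Pos.to_nat p)
  end.

Definition nome (z : C) : C := Cexp (2 * PI * Ci * z).

(* Complex differentiability: the module structure on the codomain is the one
   of [C] over itself, not over [R]. *)
Definition holomorphic_on_H (g : C -> C) : Prop :=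
  forall z : C, upper_half_plane z ->
    @ex_derive C_AbsRing C_NormedModule g z.

Definition weakly_modular (k : Z) (g : C -> C) : Prop :=
  forall a b c d : Z, (a * d - b * c = 1)%Z ->
  forall z : C, upper_half_plane z ->
    g ((IZR a * z + IZR b) / (IZR c * z + IZR d))
    = Cpow_Z (IZR c * z + IZR d) k * g z.

(* g(z) = sum_{n >= 0} a_n q^n on the upper half-plane, with q = [nome z]. *)
Definition is_fourier_expansion (g : C -> C) (a : nat -> C) : Prop :=
  forall z : C, upper_half_plane z ->
    @is_pseries C_AbsRing C_NormedModule a (nome z) (g z).

(* Holomorphy at the cusp is the absence of negative powers of q in the
   Fourier expansion. *)
Definition modular_form (k : Z) (g : C -> C) : Prop :=
  holomorphic_on_H g /\ weakly_modular k g /\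
  exists a : nat -> C, is_fourier_expansion g a.

(* The Fourier coefficients are unique, so quantifying existentially over the
   expansion in the next two definitions is harmless. *)
Definition cusp_form (k : Z) (g : C -> C) : Prop :=
  modular_form k g /\
  exists a : nat -> C, is_fourier_expansion g a /\ a 0%nat = 0.

Definition real_fourier_coefficients (g : C -> C) : Prop :=
  exists a : nat -> C, is_fourier_expansion g a /\ forall n, Im (a n) = 0%R.

(* The space S_{k,R}. *)
Definition real_cusp_form (k : Z) (g : C -> C) : Prop :=
  cusp_form k g /\ real_fourier_coefficients g.

Definition nonzero_on_H (g : C -> C) : Prop :=
  exists z : C, upper_half_plane z /\ g z <> 0.

(* [C_derive] takes the limit of the difference quotient along the real
   direction only, which is the complex derivative wherever [g] is complex
   differentiable ([is_C_derive_unique]). *)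
Definition D (g : C -> C) (z : C) : C := / (2 * PI * Ci) * C_derive g z.

(* Main.v *)
Require Import Defs.
From Stdlib Require Import Lra Lia Classical.

(** The proof is Rolle's theorem on a half-line.  Put [w = k - 2], let [x] be
    [0] or [1/2], and consider [phi t = Re (g (x + i t))] for [t > 0].

    On either line the nome [q] is real, so the reality of the Fourier
    coefficients makes [g (x + i t)] real.  Its derivative in [t] is
    [i g' (x + i t)], so [g' (x + i t)] has zero real part, and its imaginary
    part is the opposite of [phi' t].  Hence every critical point of [phi] is a zero of
    [g'], and so of [f = D g].

    A critical point exists because [phi] vanishes at both ends of the line.
    As [t] tends to infinity this is the exponential decay of a cusp form
    ([cusp_form_decay]).  As [t] tends to [0] it follows by symmetry: both
    lines are geodesics carried to themselves by an involution of the modular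
    group, [z |-> -1/z] for [x = 0] and [z |-> (z - 1) / (2 z - 1)] for
    [x = 1/2], which exchanges their two ends ([line_involution]).  The
    automorphy factor grows only like a power of [t], and exponential decay
    absorbs it ([pow_exp_decay]).  So [phi] has an extremum
    ([critical_point_of_vanishing_ends]). *)

Local Open Scope R_scope.

(** * Rolle's theorem on the half-line *)

Definition vanishes_at_ends (phi : R -> R) : Prop :=
  forall eps, 0 < eps -> exists a b, 0 < a /\
    forall t, 0 < t -> t < a \/ b < t -> Rabs (phi t) < eps.

Lemma critical_point_of_maximum (phi dphi : R -> R) (c : R) :
  (forall t, 0 < t -> derivable_pt_lim phi t (dphi t)) ->
  0 < c -> (forall t, 0 < t -> phi t <= phi c) -> dphi c = 0.
Proof.
  intros Hd Hc Hmax.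
  pose (pr := exist _ (dphi c) (Hd c Hc) : derivable_pt phi c).
  change (derive_pt phi c pr = 0).
  apply (deriv_maximum phi 0 (c + 1) c pr); try lra.
  intros x Hx _; exact (Hmax x Hx).
Qed.

(** A positive value confines the search for a maximum to a compact interval:
    outside it, the function stays below that value. *)
Lemma critical_point_of_positive_value (phi dphi : R -> R) (t0 : R) :
  (forall t, 0 < t -> derivable_pt_lim phi t (dphi t)) ->
  vanishes_at_ends phi -> 0 < t0 -> 0 < phi t0 ->
  exists t, 0 < t /\ dphi t = 0.
Proof.
  intros Hd Hv Ht0 Hp.
  destruct (Hv _ Hp) as (a & b & Ha & Hab).
  assert (Hin : a <= t0 <= b).
  { split; apply Rnot_lt_le; intro H;
      [ assert (K := Hab t0 Ht0 (or_introl H))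
      | assert (K := Hab t0 Ht0 (or_intror H)) ];
      pose proof (Rle_abs (phi t0)); lra. }
  destruct (continuity_ab_maj phi a b) as (c & Hmax & Hc); [lra | |].
  { intros t Ht; apply derivable_continuous_pt.
    exists (dphi t); apply Hd; lra. }
  exists c; split; [lra|].
  apply (critical_point_of_maximum phi); [exact Hd | lra |].
  intros t Ht.
  pose proof (Hmax t0 Hin); pose proof (Rle_abs (phi t)).
  destruct (Rlt_or_le t a) as [H1|H1];
    [pose proof (Hab t Ht (or_introl H1)); lra|].
  destruct (Rlt_or_le b t) as [H2|H2];
    [pose proof (Hab t Ht (or_intror H2)); lra|].
  apply Hmax; lra.
Qed.

Lemma critical_point_of_vanishing_ends (phi dphi : R -> R) :
  (forall t, 0 < t -> derivable_pt_lim phi t (dphi t)) ->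
  vanishes_at_ends phi ->
  exists t, 0 < t /\ dphi t = 0.
Proof.
  intros Hd Hv.
  destruct (classic (exists t, 0 < t /\ 0 < phi t)) as [(t & Ht & Hp)|Hn].
  { exact (critical_point_of_positive_value phi dphi t Hd Hv Ht Hp). }
  assert (Hneg : forall t, 0 < t -> phi t <= 0).
  { intros t Ht; apply Rnot_lt_le; intro H; apply Hn; exists t; auto. }
  destruct (Rlt_or_le (phi 1) 0) as [H1|H1].
  - destruct (critical_point_of_positive_value
                (fun t => - phi t) (fun t => - dphi t) 1)
      as (t & Ht & H); try lra.
    + intros t Ht; exact (derivable_pt_lim_opp phi t _ (Hd t Ht)).
    + intros eps He; destruct (Hv eps He) as (a & b & Ha & Hab).
      exists a, b; split; [exact Ha|].
      intros t Ht Ho; rewrite Rabs_Ropp; auto.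
    + exists t; split; lra.
  - exists 1; split; [lra|].
    apply (critical_point_of_maximum phi); [exact Hd | lra |].
    intros t Ht; pose proof (Hneg t Ht); lra.
Qed.

Lemma exp_le (x y : R) : x <= y -> exp x <= exp y.
Proof.
  intros [H|H]; [left; apply exp_increasing; exact H | rewrite H; lra].
Qed.

(** The Taylor term of degree [N + 1] of [exp t] bounds [t ^ N * exp (- t)] by
    [(N + 1)! / t]. *)
Lemma pow_exp_decay (N : nat) (A eps : R) :
  0 <= A -> 0 < eps ->
  exists T, 1 <= T /\ forall t, T <= t -> A * (t ^ N * exp (- t)) < eps.
Proof.
  intros HA He.
  set (F := INR (fact (S N))).
  assert (HF : 0 < F) by apply INR_fact_lt_0.
  exists (1 + A * F / eps).
  assert (Hq : 0 <= A * F / eps).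
  { apply Rmult_le_pos; [nra|]. left; apply Rinv_0_lt_compat; exact He. }
  split; [lra|]. intros t Ht.
  assert (Htaylor : t ^ S N / F <= exp t).
  { eapply Rle_trans; [|apply (exp_ge_taylor t (S N)); lra].
    rewrite tech5. fold F.
    assert (0 <= sum_f_R0 (fun k => t ^ k / INR (fact k)) N); [|lra].
    apply cond_pos_sum; intro n; apply Rmult_le_pos.
    - apply pow_le; lra.
    - left; apply Rinv_0_lt_compat, INR_fact_lt_0. }
  assert (Hexp : exp t * exp (- t) = 1).
  { rewrite <- exp_plus, Rplus_opp_r; apply exp_0. }
  pose proof (exp_pos (- t)) as Hpos.
  assert (Hb : t * (t ^ N * exp (- t)) <= F).
  { replace (t * (t ^ N * exp (- t))) with (t ^ S N / F * exp (- t) * F)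
      by (simpl; field; lra).
    assert (t ^ S N / F * exp (- t) <= 1); [|nra].
    rewrite <- Hexp; apply Rmult_le_compat_r; lra. }
  assert (HAt : A * F < eps * t).
  { apply Rlt_le_trans with (eps * (1 + A * F / eps)).
    - replace (eps * (1 + A * F / eps)) with (eps + A * F) by (field; lra). lra.
    - apply Rmult_le_compat_l; lra. }
  apply Rmult_lt_reg_l with t; [lra|].
  apply Rle_lt_trans with (A * F); [|lra].
  replace (t * (A * (t ^ N * exp (- t)))) with (A * (t * (t ^ N * exp (- t))))
    by ring.
  apply Rmult_le_compat_l; assumption.
Qed.

(** * Growth at the cusp and reality on the two lines *)

(** A convergent series is bounded term by term, here at radius [Cmod q0];
    at radius at most half of that one, the series is dominated by a geometric
    series of ratio [1/2], and its first term is of degree at least [1]. *)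
Lemma pseries_linear_bound (a : nat -> C) (q0 l0 : C) :
  a 0%nat = RtoC 0 -> q0 <> RtoC 0 ->
  @is_pseries C_AbsRing C_NormedModule a q0 l0 ->
  exists M, 0 <= M /\ forall q l,
    Cmod q <= Cmod q0 / 2 ->
    @is_pseries C_AbsRing C_NormedModule a q l ->
    Cmod l <= M * Cmod q.
Proof.
  intros Ha0 Hq0 Hser.
  set (u q n := @scal C_AbsRing C_NormedModule (pow_n q n) (a n)).
  assert (HB : exists B, forall n, Cmod (sum_n (u q0) n) <= B).
  { destruct (filterlim_bounded _ (ex_intro _ l0 Hser)) as [B HB].
    exists B; exact HB. }
  destruct HB as [B HB].
  assert (Hu : forall q n, Cmod (u q n) = Cmod q ^ n * Cmod (a n)).
  { intros q n; unfold u.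
    change (Cmod (pow_n (K := C_Ring) q n * a n)%C = Cmod q ^ n * Cmod (a n)).
    rewrite Cmod_mult; f_equal.
    exact (Cmod_pow q n). }
  assert (HB0 : 0 <= B).
  { eapply Rle_trans; [apply Cmod_ge_0 | apply (HB 0%nat)]. }
  assert (Hr : 0 < Cmod q0) by (apply Cmod_gt_0; exact Hq0).
  assert (Hterm : forall n, Cmod q0 ^ n * Cmod (a n) <= 2 * B).
  { intros [|n].
    - rewrite Ha0, Cmod_0; lra.
    - rewrite <- Hu.
      (* A term is the difference of two consecutive partial sums. *)
      replace (u q0 (S n)) with
        (sum_n (u q0) (S n) + - sum_n (u q0) n)%C.
      + eapply Rle_trans; [apply Cmod_triangle|].
        rewrite Cmod_opp.
        pose proof (HB n) as H1; pose proof (HB (S n)) as H2.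
        lra.
      + rewrite sum_Sn. unfold plus; simpl. ring. }
  exists (4 * B / Cmod q0); split.
  { apply Rmult_le_pos; [lra|]. left; apply Rinv_0_lt_compat; exact Hr. }
  intros q l Hq Hl.
  set (y := Cmod q / Cmod q0).
  assert (Hy : 0 <= y <= / 2).
  { unfold y; split.
    - apply Rmult_le_pos; [apply Cmod_ge_0|].
      left; apply Rinv_0_lt_compat; exact Hr.
    - apply Rmult_le_reg_r with (Cmod q0); [exact Hr|].
      replace (Cmod q / Cmod q0 * Cmod q0) with (Cmod q) by (field; lra).
      lra. }
  assert (Hqy : Cmod q = y * Cmod q0) by (unfold y; field; lra).
  assert (Hle : forall n, Cmod (u q (S n)) <= 2 * B * (y * (/ 2) ^ n)).
  { intro n; rewrite Hu, Hqy, Rpow_mult_distr.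
    replace (y ^ S n * Cmod q0 ^ S n * Cmod (a (S n)))
      with (Cmod q0 ^ S n * Cmod (a (S n)) * (y * y ^ n)) by (simpl; ring).
    apply Rmult_le_compat.
    - apply Rmult_le_pos; [apply pow_le; lra | apply Cmod_ge_0].
    - apply Rmult_le_pos; [lra | apply pow_le; lra].
    - apply Hterm.
    - apply Rmult_le_compat_l; [lra|]. apply pow_incr; lra. }
  assert (Hsum : forall n, Cmod (sum_n (u q) n) <= 4 * B * y * (1 - (/ 2) ^ n)).
  { induction n as [|n IH].
    - rewrite sum_O, Hu, Ha0, Cmod_0; simpl; lra.
    - rewrite sum_Sn.
      eapply Rle_trans; [apply (Cmod_triangle (sum_n (u q) n) (u q (S n)))|].
      specialize (Hle n). simpl (_ ^ S n). lra. }
  replace (4 * B / Cmod q0 * Cmod q) with (4 * B * y) by (unfold y; field; lra).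
  change (Rbar_le (Cmod l) (4 * B * y)).
  apply (is_lim_seq_le (fun n => Cmod (sum_n (u q) n)) (fun _ => 4 * B * y)).
  - intro n; specialize (Hsum n).
    assert (0 <= (/ 2) ^ n) by (apply pow_le; lra).
    assert (0 <= B * y * (/ 2) ^ n)
      by (apply Rmult_le_pos; [apply Rmult_le_pos; lra | assumption]).
    lra.
  - exact (filterlim_comp _ _ _ _ _ _ _ _ Hl (filterlim_norm l)).
  - apply is_lim_seq_const.
Qed.

Lemma Cmod_nome (z : C) : Cmod (nome z) = exp (- (2 * PI * Im z)).
Proof.
  unfold nome, Cexp, Cmod; cbn [fst snd].
  replace (Re (2 * PI * Ci * z)) with (- (2 * PI * Im z))
    by (unfold Re, Im, Ci, RtoC, Cmult; simpl; ring).
  set (e := exp _); set (v := Im _).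
  pose proof (sin2_cos2 v) as Hsc; unfold Rsqr in Hsc.
  replace ((e * cos v) ^ 2 + (e * sin v) ^ 2) with (e ^ 2).
  - apply sqrt_pow2; left; apply exp_pos.
  - transitivity (e ^ 2 * (sin v * sin v + cos v * cos v)); [|ring].
    rewrite Hsc; ring.
Qed.

(** The linear bound is used with [q0] the nome of [i / 2], at which the
    Fourier expansion converges. *)
Lemma cusp_form_decay (w : Z) (g : C -> C) :
  cusp_form w g ->
  exists M, 0 <= M /\ forall z, 1 <= Im z ->
    Cmod (g z) <= M * exp (- (2 * PI * Im z)).
Proof.
  intros [_ (a & Ha & Ha0)].
  pose proof PI2_3_2 as HPI.
  set (z0 := (0, / 2) : C).
  assert (Hz0 : upper_half_plane z0) by (unfold upper_half_plane; simpl; lra).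
  assert (Hq0 : Cmod (nome z0) = exp (- PI)).
  { rewrite Cmod_nome; f_equal; simpl; field. }
  destruct (pseries_linear_bound a (nome z0) (g z0) Ha0) as (M & HM & Hbound).
  - apply Cmod_gt_0; rewrite Hq0; apply exp_pos.
  - exact (Ha z0 Hz0).
  - exists M; split; [exact HM|]. intros z Hz.
    rewrite <- Cmod_nome. apply Hbound.
    + rewrite Hq0, Cmod_nome.
      (* [exp (- 2 PI)] is at most half of [exp (- PI)], as [2 <= exp PI]. *)
      apply Rle_trans with (exp (- PI + - PI)).
      * apply exp_le. nra.
      * rewrite exp_plus.
        assert (exp (- PI) <= / 2).
        { rewrite exp_Ropp. apply Rinv_le_contravar; [lra|].
          pose proof (exp_ineq1_le PI); lra. }
        pose proof (exp_pos (- PI)); nra.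
    + apply Ha; unfold upper_half_plane; lra.
Qed.

Lemma pseries_real (a : nat -> C) (q l : C) :
  (forall n, Im (a n) = 0) -> Im q = 0 ->
  @is_pseries C_AbsRing C_NormedModule a q l -> Im l = 0.
Proof.
  intros Ha Hq Hl.
  set (u n := @scal C_AbsRing C_NormedModule (pow_n q n) (a n)).
  assert (Hpow : forall n, Im (pow_n (K := C_Ring) q n) = 0).
  { induction n as [|n IH]; [reflexivity|].
    change (Im (q * pow_n (K := C_Ring) q n)%C = 0).
    rewrite im_mult, IH, Hq; ring. }
  assert (Hsum : forall n, Im (sum_n u n) = 0).
  { assert (Hu : forall n, Im (u n) = 0).
    { intro n; change (Im (pow_n (K := C_Ring) q n * a n)%C = 0).
      rewrite im_mult, Hpow, Ha; ring. }
    induction n as [|n IH]; [rewrite sum_O; apply Hu|].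
    rewrite sum_Sn.
    change (Im (sum_n u n) + Im (u (S n)) = 0).
    rewrite IH, Hu; ring. }
  assert (Hlim : is_lim_seq (fun n => Im (sum_n u n)) (Im l)).
  { destruct l as [l1 l2].
    exact (filterlim_comp _ _ _ (sum_n u) snd _ _ _ Hl
             (@continuous_snd R_UniformSpace R_UniformSpace l1 l2)). }
  apply is_lim_seq_unique in Hlim.
  rewrite (Lim_seq_ext _ (fun _ => 0) Hsum), Lim_seq_const in Hlim.
  injection Hlim; auto.
Qed.

(** * The symmetry of the lines *)

Lemma Cmod_Cpow_Z_le (z : C) (w : Z) :
  1 <= Cmod z -> Cmod (Cpow_Z z w) <= Cmod z ^ Z.abs_nat w.
Proof.
  intro Hz; destruct w as [|p|p]; cbn [Cpow_Z Z.abs_nat].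
  - rewrite Cmod_1; simpl; lra.
  - rewrite Cmod_pow; lra.
  - assert (H1 : 1 <= Cmod z ^ Pos.to_nat p) by (apply pow_R1_Rle; exact Hz).
    rewrite Cmod_inv, Cmod_pow.
    + apply Rle_trans with 1; [|exact H1].
      rewrite <- Rinv_1; apply Rinv_le_contravar; lra.
    + apply Cmod_gt_0; rewrite Cmod_pow; lra.
Qed.

(** A matrix of determinant [1] and trace [0] acts as an involution; when its
    pole is the end [x = a / c] of a vertical line, its value at infinity is
    the same point, and so it reverses the line. *)
Lemma line_involution (a b c : Z) (x t : R) :
  (a * (- a) - b * c = 1)%Z -> 0 < IZR c -> IZR a = IZR c * x -> 0 < t ->
  ((IZR a * (x, t) + IZR b) / (IZR c * (x, t) + IZR (- a)))%C
    = (x, / (IZR c ^ 2 * t)).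
Proof.
  intros Hdet Hc Ha Ht.
  apply (f_equal IZR) in Hdet.
  rewrite minus_IZR, !mult_IZR, opp_IZR, Ha in Hdet.
  rewrite opp_IZR, Ha.
  assert (Hb : IZR b * IZR c = - 1 - (IZR c * x) ^ 2) by (simpl; lra).
  assert (Hct : 0 < IZR c * t) by (apply Rmult_lt_0_compat; assumption).
  assert (Hden : (IZR c * (x, t) + (- (IZR c * x))%R)%C = (0, IZR c * t)).
  { apply injective_projections; unfold Cmult, Cplus, RtoC; simpl; ring. }
  rewrite Hden.
  assert (Hden0 : (0, IZR c * t) <> RtoC 0) by (intro E; injection E; lra).
  replace ((IZR c * x)%R * (x, t) + IZR b)%C
    with ((x, / (IZR c ^ 2 * t))%R * (0, IZR c * t)%R)%C.
  { unfold Cdiv; rewrite <- Cmult_assoc, Cinv_r by exact Hden0.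
    apply Cmult_1_r. }
  assert (Hb' : IZR b = (- 1 - (IZR c * x) ^ 2) / IZR c)
    by (rewrite <- Hb; field; lra).
  rewrite Hb'.
  apply injective_projections; unfold Cmult, Cplus, RtoC; simpl; field; lra.
Qed.

(** At the lower end, [g] is evaluated at the image under the involution of a
    point [x + i t'] with [t'] large, where modularity compares it with the
    exponentially small [g (x + i t')]. *)
Lemma cusp_form_vanishes_at_ends (w : Z) (g : C -> C) (a b c : Z) (x : R) :
  cusp_form w g ->
  (a * (- a) - b * c = 1)%Z -> (0 < c)%Z -> IZR a = IZR c * x ->
  vanishes_at_ends (fun t => Re (g (x, t))).
Proof.
  intros Hg Hdet Hc Ha eps Heps.
  destruct (cusp_form_decay w g Hg) as (M & HM & Hdecay).
  destruct Hg as [(_ & Hmod & _) _].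
  pose proof PI2_3_2 as HPI.
  set (N := Z.abs_nat w).
  assert (Hc1 : 1 <= IZR c) by (apply IZR_le; lia).
  assert (HcN : 1 <= IZR c ^ N) by (apply pow_R1_Rle; exact Hc1).
  destruct (pow_exp_decay N (M * IZR c ^ N) eps) as (T & HT & Hsmall);
    [apply Rmult_le_pos; lra | exact Heps |].
  assert (Hg_le : forall t, T <= t -> Cmod (g (x, t)) <= M * exp (- t)).
  { intros t Ht. eapply Rle_trans; [apply Hdecay; simpl; lra|].
    apply Rmult_le_compat_l; [exact HM|]. apply exp_le; simpl; nra. }
  assert (Hc2 : 0 < IZR c ^ 2) by nra.
  exists (/ (IZR c ^ 2 * T)), T; split; [apply Rinv_0_lt_compat; nra|].
  intros t Ht [Hsm|Hlg]; (eapply Rle_lt_trans; [apply re_le_Cmod|]).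
  - set (t' := / (IZR c ^ 2 * t)).
    assert (Ht' : T < t').
    { unfold t'. rewrite <- (Rinv_inv T).
      apply Rinv_lt_contravar.
      - apply Rmult_lt_0_compat; [nra | apply Rinv_0_lt_compat; lra].
      - apply Rmult_lt_reg_r with (/ IZR c ^ 2);
          [apply Rinv_0_lt_compat; exact Hc2|].
        replace (IZR c ^ 2 * t * / IZR c ^ 2) with t by (field; lra).
        rewrite <- Rinv_mult, Rmult_comm; exact Hsm. }
    assert (Htt : t = / (IZR c ^ 2 * t')) by (unfold t'; field; lra).
    rewrite Htt, <- (line_involution a b c x t' Hdet) by (auto; lra).
    rewrite (Hmod _ _ _ _ Hdet) by (unfold upper_half_plane; simpl; lra).
    (* The automorphy factor is purely imaginary, as [c x = a]. *)
    assert (Hfac : (IZR c * (x, t') + IZR (- a))%C = (IZR c * t' * Ci)%C).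
    { rewrite opp_IZR, Ha.
      apply injective_projections; unfold Ci, Cmult, Cplus, RtoC; simpl; ring. }
    assert (HCmod : Cmod (IZR c * t' * Ci) = IZR c * t').
    { rewrite !Cmod_mult, Cmod_Ci, !Cmod_R, !Rabs_pos_eq by lra. ring. }
    rewrite Hfac, Cmod_mult.
    eapply Rle_lt_trans; [|apply (Hsmall t'); lra].
    apply Rle_trans with ((IZR c * t') ^ N * (M * exp (- t'))).
    + apply Rmult_le_compat; try apply Cmod_ge_0; [|apply Hg_le; lra].
      rewrite <- HCmod. apply Cmod_Cpow_Z_le. rewrite HCmod; nra.
    + rewrite Rpow_mult_distr; right; ring.
  - eapply Rle_lt_trans; [apply Hg_le; lra|].
    eapply Rle_lt_trans; [|apply (Hsmall t); lra].
    assert (1 <= t ^ N) by (apply pow_R1_Rle; lra).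
    assert (1 <= IZR c ^ N * t ^ N) by nra.
    replace (M * IZR c ^ N * (t ^ N * exp (- t)))
      with (M * exp (- t) * (IZR c ^ N * t ^ N)) by ring.
    assert (0 <= M * exp (- t))
      by (apply Rmult_le_pos; [exact HM | left; apply exp_pos]).
    nra.
Qed.

(** * Critical points on a vertical line *)

(** Real and imaginary parts of the chain rule: along [s |-> x + i s] the
    derivative of [g] is [i l]. *)
Lemma derivative_along_vertical_line (g : C -> C) (x t : R) (l : C) :
  @is_derive C_AbsRing C_NormedModule g (x, t) l ->
  derivable_pt_lim (fun s => Re (g (x, s))) t (- Im l) /\
  derivable_pt_lim (fun s => Im (g (x, s))) t (Re l).
Proof.
  intros [_ Hd].
  specialize (Hd (x, t) (fun P H => H)).
  assert (Hquot : forall eps, 0 < eps -> exists delta : posreal,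
    forall h, h <> 0 -> Rabs h < delta ->
      Cmod (g (x, t + h)%R - g (x, t) - h * Ci * l)%C < eps * Rabs h).
  { intros eps He.
    (* Differentiability gives a weak inequality; halving [eps] makes it
       strict. *)
    assert (He2 : 0 < eps / 2) by lra.
    destruct (Hd (mkposreal _ He2)) as [delta Hdelta].
    exists delta; intros h Hh0 Hh.
    assert (Hdiff : ((x, t + h)%R - (x, t))%C = (h * Ci)%C).
    { apply injective_projections;
        unfold Ci, Cminus, Cmult, Cplus, Copp, RtoC; simpl; ring. }
    assert (Hnorm : Cmod ((x, t + h)%R - (x, t))%C = Rabs h).
    { rewrite Hdiff, Cmod_mult, Cmod_Ci, Cmod_R; ring. }
    specialize (Hdelta (x, t + h)%R).
    assert (Hball : ball (M := AbsRing_UniformSpace C_AbsRing)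
                      (x, t) delta (x, t + h)%R).
    { change (Cmod ((x, t + h)%R - (x, t))%C < delta). rewrite Hnorm; exact Hh. }
    specialize (Hdelta Hball).
    change (Cmod (g (x, t + h)%R - g (x, t) - ((x, t + h)%R - (x, t)) * l)%C
       <= eps / 2 * Cmod ((x, t + h)%R - (x, t))%C) in Hdelta.
    rewrite Hnorm, Hdiff in Hdelta.
    assert (0 < Rabs h) by (apply Rabs_pos_lt; exact Hh0).
    nra. }
  split; intros eps He; destruct (Hquot eps He) as [delta H]; exists delta;
    intros h Hh0 Hh; specialize (H h Hh0 Hh);
    assert (Hpos : 0 < Rabs h) by (apply Rabs_pos_lt; exact Hh0);
    apply Rmult_lt_reg_r with (Rabs h); try exact Hpos;
    rewrite <- Rabs_mult;
    (eapply Rle_lt_trans; [|exact H]).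
  - eapply Rle_trans; [|apply re_le_Cmod].
    right; f_equal.
    unfold Re, Im, Ci, Cminus, Cmult, Cplus, Copp, RtoC; simpl; field; exact Hh0.
  - eapply Rle_trans; [|eapply Rle_trans; [apply Rmax_r | apply Rmax_Cmod]].
    right; f_equal.
    unfold Re, Im, Ci, Cminus, Cmult, Cplus, Copp, RtoC; simpl; field; exact Hh0.
Qed.

(** The condition on the sine says that the nome is real on the line. *)
Lemma D_zero_on_vertical_line (w : Z) (g : C -> C) (a b c : Z) (x : R) :
  real_cusp_form w g ->
  (a * (- a) - b * c = 1)%Z -> (0 < c)%Z -> IZR a = IZR c * x ->
  sin (2 * PI * x) = 0 ->
  exists t, 0 < t /\ D g (x, t) = RtoC 0.
Proof.
  intros [Hcusp (r & Hr & Hreal)] Hdet Hc Ha Hsin.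
  assert (Hholo : forall t, 0 < t ->
    @is_derive C_AbsRing C_NormedModule g (x, t) (C_derive g (x, t))).
  { intros t Ht.
    destruct (proj1 (proj1 Hcusp) (x, t) Ht) as [l Hl].
    rewrite (is_C_derive_unique _ _ _ Hl); exact Hl. }
  assert (Hg_real : forall t, 0 < t -> Im (g (x, t)) = 0).
  { intros t Ht.
    apply (pseries_real r (nome (x, t))); [exact Hreal | | exact (Hr (x, t) Ht)].
    unfold nome, Cexp; cbn [Im snd].
    replace (Im (2 * PI * Ci * (x, t))) with (2 * PI * x)
      by (unfold Im, Ci, RtoC, Cmult; simpl; ring).
    change (exp (Re (2 * PI * Ci * (x, t))) * sin (2 * PI * x) = 0).
    rewrite Hsin; ring. }
  destruct (critical_point_of_vanishing_ends
              (fun t => Re (g (x, t))) (fun t => - Im (C_derive g (x, t))))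
    as (t & Ht & Hcrit).
  { intros t Ht.
    exact (proj1 (derivative_along_vertical_line g x t _ (Hholo t Ht))). }
  { exact (cusp_form_vanishes_at_ends w g a b c x Hcusp Hdet Hc Ha). }
  exists t; split; [exact Ht|].
  assert (HRe : Re (C_derive g (x, t)) = 0).
  { (* [Im g] is identically [0] on the line, so every point is a maximum. *)
    apply (critical_point_of_maximum (fun s => Im (g (x, s)))
             (fun s => Re (C_derive g (x, s))) t); [|exact Ht|].
    - intros s Hs.
      exact (proj2 (derivative_along_vertical_line g x s _ (Hholo s Hs))).
    - intros s Hs; rewrite !Hg_real by assumption; lra. }
  unfold D.
  replace (C_derive g (x, t)) with (RtoC 0); [apply Cmult_0_r|].
  apply injective_projections; symmetry; [exact HRe|].
  change (Im (C_derive g (x, t)) = 0); lra.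
Qed.

Local Open Scope C_scope.

Theorem theorem1p3 (k : Z) (hk : Z.Even k) (f g : C -> C)
  (hg : real_cusp_form (k - 2)%Z g) (hg0 : nonzero_on_H g)
  (hf : forall z : C, upper_half_plane z -> f z = D g z) :
  exists z1 z2 : C,
    z1 <> z2 /\
    (upper_half_plane z1 /\ Re z1 = 0%R /\ f z1 = 0) /\
    (upper_half_plane z2 /\ Re z2 = (1 / 2)%R /\ f z2 = 0).
Proof.
  (* [z |-> -1/z] *)
  destruct (D_zero_on_vertical_line (k - 2) g 0 (-1) 1 0 hg)
    as (t1 & Ht1 & H1); [reflexivity | lia | simpl; ring | |].
  { rewrite Rmult_0_r; apply sin_0. }
  (* [z |-> (z - 1) / (2 z - 1)] *)
  destruct (D_zero_on_vertical_line (k - 2) g 1 (-1) 2 (1 / 2) hg)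
    as (t2 & Ht2 & H2); [reflexivity | lia | simpl; field | |].
  { replace (2 * PI * (1 / 2))%R with PI by field; apply sin_PI. }
  exists (0%R, t1), (1 / 2, t2)%R.
  split; [intro E; injection E; lra|].
  split; (split; [assumption|]; split; [reflexivity|]);
    rewrite hf by assumption; assumption.
Qed.
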